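(* Let $G$ be an infinite commutative group. The functional $M^*$ is an upper mean on $G$, and $M_*$ is its conjugate lower mean. Among all upper means $M^*$ is maximal, i.e. $\overline M(f)\le M^*(f)$ for every upper mean $\overline M$ and every bounded function $f:G\to\mathbb{R}$; and among all lower means $M_*$ is minimal, i.e. $\underline M(f)\ge M_*(f)$ for every lower mean $\underline M$ and every bounded function $f:G\to\mathbb{R}$.
   Context: $G$ is an infinite commutative (discrete) group, written additively. An upper mean is a functional $\overline M$ assigning a real number to every bounded function $f:G\to\mathbb{R}$ such that: (norming) $\overline M(f)=c$ if $f\equiv c$; (monotonicity) $f\le g$ implies $\overline M(f)\le\overline M(g)$; (homogeneity) $\overline M(cf)=c\overline M(f)$ for every constant $c\ge0$; (restricted additivity) if $t\in G$ and $g(x)=f(x)+f(x+t)$, then $\overline M(g)=2\overline M(f)$; (subadditivity) $\overline M(f+g)\le\overline M(f)+\overline M(g)$. A lower mean satisfies the same requirements with subadditivity replaced by superadditivity $\underline M(f+g)\ge\underline M(f)+\underline M(g)$. The conjugate lower mean of an upper mean $\overline M$ is $\underline M(f)=-\overline M(-f)$. For a bounded function $f:G\to\mathbb{R}$ consider all convex combinations of translates, that is, all functions $g(x)=\sum_{i=1}^n c_i f(x+t_i)$ with $n\ge1$, $t_i\in G$, $c_i\ge0$, $\sum c_i=1$. Put $$M^*(f)=\inf_g\sup_x g(x),\qquad M_*(f)=\sup_g\inf_x g(x),$$ where $g$ runs over all such functions. *)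

(* Defs.v *)
From HB Require Import structures.
From mathcomp Require Import all_boot all_order all_algebra.
From mathcomp Require Import all_classical all_reals all_analysis.
Import Order.TTheory GRing.Theory Num.Theory.
Import numFieldNormedType.Exports.

Set Implicit Arguments.
Unset Strict Implicit.
Unset Printing Implicit Defensive.

Local Open Scope classical_set_scope.
Local Open Scope ring_scope.

(* A functional on the bounded functions G -> R is represented by a total map
   M : (G -> R) -> R of which only the values at bounded functions matter:
   every requirement below is restricted to bounded functions. *)

(* The requirements common to upper and lower means. *)
Record mean_axioms (R : realType) (G : zmodType) (M : (G -> R) -> R) : Prop :=
  MeanAxioms {
    mean_norming : forall c : R, M (fun=> c) = c;
    mean_monotone : forall f g : G -> R, bounded_fun f -> bounded_fun g ->
      (forall x, f x <= g x) -> M f <= M g;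
    mean_homogeneous : forall (c : R) (f : G -> R), bounded_fun f -> 0 <= c ->
      M (fun x => c * f x) = c * M f;
    mean_restricted_additive : forall (t : G) (f : G -> R), bounded_fun f ->
      M (fun x => f x + f (x + t)) = 2 * M f
  }.

Record upper_mean (R : realType) (G : zmodType) (M : (G -> R) -> R) : Prop :=
  UpperMean {
    upper_mean_axioms : mean_axioms M;
    upper_mean_subadditive : forall f g : G -> R,
      bounded_fun f -> bounded_fun g ->
      M (fun x => f x + g x) <= M f + M g
  }.

Record lower_mean (R : realType) (G : zmodType) (M : (G -> R) -> R) : Prop :=
  LowerMean {
    lower_mean_axioms : mean_axioms M;
    lower_mean_superadditive : forall f g : G -> R,
      bounded_fun f -> bounded_fun g ->
      M f + M g <= M (fun x => f x + g x)
  }.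

Definition conjugate_mean (R : realType) (G : zmodType) (M : (G -> R) -> R)
    (f : G -> R) : R :=
  - M (fun x => - f x).

Definition translate_combinations (R : realType) (G : zmodType) (f : G -> R) :
    set (G -> R) :=
  [set g | exists (n : nat) (c : 'I_n -> R) (t : 'I_n -> G),
     [/\ (1 <= n)%N, forall i, 0 <= c i, \sum_(i < n) c i = 1 &
         g = (fun x => \sum_(i < n) c i * f (x + t i))]].

(* The library's real-valued [sup] and [inf] are the genuine supremum and
   infimum in the next two definitions when f is bounded, since all the sets
   involved are then nonempty and bounded. *)
Definition upper_star (R : realType) (G : zmodType) (f : G -> R) : R :=
  inf [set sup (range g) | g in translate_combinations f].

Definition lower_star (R : realType) (G : zmodType) (f : G -> R) : R :=
  sup [set inf (range g) | g in translate_combinations f].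

(* Main.v *)
(** For an upper mean [M], the differences [h t x = f x - f (x + t)] satisfy
    [h t x + h t (x + t) = h (t + t) x], so restricted additivity gives
    [M (h (2^k t)) = 2^k M (h t)]. The left side is bounded uniformly in [k],
    hence [M (h t) <= 0]. For a convex combination of translates
    [g x = \sum_i c_i f (x + t_i)], subadditivity then gives
    [M f <= M g + \sum_i c_i M (h t_i) <= M g <= sup g], which is the maximality
    of [M^*]. The statements on lower means follow by conjugation. *)
Require Import Defs.
From HB Require Import structures.
From mathcomp Require Import all_boot all_order all_algebra.
From mathcomp Require Import all_classical all_reals all_analysis.
Import Order.TTheory GRing.Theory Num.Theory.
Import numFieldNormedType.Exports.
Local Open Scope classical_set_scope.
Local Open Scope ring_scope.

(** * Closure properties of bounded functions *)

Lemma bounded_funP (R : realType) (T : Type) (f : T -> R) :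
  bounded_fun f <-> exists B : R, forall x, `|f x| <= B.
Proof.
split.
  (* [bounded_fun] only promises that every constant strictly above [B] is a bound, hence
     [B + 1]. *)
  by move=> [B [_ HB]]; exists (B + 1) => x; apply: HB; rewrite ?ltrDl.
move=> [B HB]; exists B; split; first exact: num_real.
by move=> C /ltW BC x _; exact: le_trans (HB x) BC.
Qed.

Section Bounded.
Context {R : realType} {G : zmodType}.
Implicit Types f g : G -> R.

Lemma bounded_funD f g :
  bounded_fun f -> bounded_fun g -> bounded_fun (fun x => f x + g x).
Proof.
move=> /bounded_funP[A HA] /bounded_funP[B HB]; apply/bounded_funP.
by exists (A + B) => x; apply: (le_trans (ler_normD _ _)); apply: lerD.
Qed.

Lemma bounded_funN f : bounded_fun f -> bounded_fun (fun x => - f x).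
Proof.
move=> /bounded_funP[A HA]; apply/bounded_funP.
by exists A => x; rewrite normrN.
Qed.

Lemma bounded_funZ (c : R) f : bounded_fun f -> bounded_fun (fun x => c * f x).
Proof.
move=> /bounded_funP[A HA]; apply/bounded_funP.
by exists (`|c| * A) => x; rewrite normrM ler_wpM2l.
Qed.

Lemma bounded_fun_shift (t : G) f :
  bounded_fun f -> bounded_fun (fun x => f (x + t)).
Proof. by move=> /bounded_funP[A HA]; apply/bounded_funP; exists A. Qed.

Lemma bounded_fun_cst (c : R) : bounded_fun (fun _ : G => c).
Proof. by apply/bounded_funP; exists `|c|. Qed.

Lemma bounded_fun_sum (I : Type) (r : seq I) (F : I -> G -> R) :
  (forall i, bounded_fun (F i)) -> bounded_fun (fun x => \sum_(i <- r) F i x).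
Proof.
move=> HF; elim: r => [|i r /bounded_funP[B HB]]; apply/bounded_funP.
  by exists 0 => x; rewrite big_nil normr0.
have /bounded_funP[A HA] := HF i; exists (A + B) => x.
by rewrite big_cons; apply: le_trans (ler_normD _ _) _; exact: lerD.
Qed.

End Bounded.

(** * Finite convex sums of reals *)

Section Convex.
Context {R : realType}.

Lemma convex_sum_le (I : finType) (c F : I -> R) (a : R) :
  (forall i, 0 <= c i) -> \sum_i c i = 1 -> (forall i, F i <= a) ->
  \sum_i c i * F i <= a.
Proof.
move=> c0 c1 Fa; rewrite -[leRHS]mul1r -c1 mulr_suml.
by apply: ler_sum => i _; exact: ler_wpM2l.
Qed.

(** Product weights arise when two averaging operators are composed. *)
Lemma convex_sum_prod (I J : finType) (c : I -> R) (d : J -> R) :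
  \sum_i c i = 1 -> \sum_j d j = 1 -> \sum_(p : I * J) c p.1 * d p.2 = 1.
Proof.
move=> c1 d1; rewrite -(pair_bigA _ (fun i j => c i * d j)) /=.
by under eq_bigr do rewrite -mulr_sumr d1 mulr1.
Qed.

End Convex.

(** * Convex combinations of translates *)

Section TranslateCombinations.
Context {R : realType} {G : zmodType}.
Implicit Types f g : G -> R.

(** Reindexing along [enum_val] frees the index set from the form ['I_n], so that products such as
    ['I_n * 'I_m] and ['I_n * bool] can index combinations. *)
Lemma translate_combinations_fin (I : finType) (c : I -> R) (t : I -> G) f :
  (forall i, 0 <= c i) -> \sum_i c i = 1 ->
  translate_combinations f (fun x => \sum_i c i * f (x + t i)).
Proof.
move=> c0 c1.
exists #|I|, (c \o enum_val), (t \o enum_val); split => //.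
- case: (pickP I) => [i _|I0]; first by apply/card_gt0P; exists i.
  (* Over an empty index type the weights would sum to 0 instead of 1. *)
  by move: c1; rewrite big_pred0 // => /esym/eqP; rewrite oner_eq0.
- by move=> i; exact: c0.
- by rewrite -c1 [RHS](reindex (@enum_val I I)) //=; exact/onW_bij/enum_val_bij.
- apply/funext => x.
  by rewrite (reindex (@enum_val I I)) //=; exact/onW_bij/enum_val_bij.
Qed.

Lemma translate_combinations_refl f : translate_combinations f f.
Proof.
exists 1%N, (fun=> 1), (fun=> 0); split => //; first by rewrite big_ord1.
by apply/funext => x; rewrite big_ord1 addr0 mul1r.
Qed.

Lemma translate_combinations_bounded f g :
  bounded_fun f -> translate_combinations f g -> bounded_fun g.
Proof.
move=> bf [n [c [t [_ _ _ ->]]]].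
by apply: bounded_fun_sum => i; exact/bounded_funZ/bounded_fun_shift.
Qed.

Lemma translate_combinationsN f g : translate_combinations f g ->
  translate_combinations (fun x => - f x) (fun x => - g x).
Proof.
move=> [n [c [t [n0 c0 c1 ->]]]]; exists n, c, t; split=> //.
by apply/funext => x; rewrite -sumrN; apply: eq_bigr => i _; rewrite mulrN.
Qed.

End TranslateCombinations.

(** * [upper_star] is an upper mean *)

Section UpperStar.
Context {R : realType} {G : zmodType}.
Implicit Types f g : G -> R.

Lemma range_has_sup g : bounded_fun g -> has_sup (range g).
Proof.
move=> /bounded_funP[B HB]; split; first by exists (g 0), 0.
by exists B => _ [x _ <-]; exact: le_trans (ler_norm _) (HB x).
Qed.

Lemma sup_range_le g (a : R) : (forall x, g x <= a) -> sup (range g) <= a.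
Proof.
by move=> ga; apply: ge_sup; [exists (g 0), 0 | move=> _ [x _ <-]; exact: ga].
Qed.

Lemma le_sup_range g x : bounded_fun g -> g x <= sup (range g).
Proof. by move=> /range_has_sup[_ ub]; apply: ub_le_sup => //; exists x. Qed.

(** If [-B <= f], every combination of translates stays above [-B], and so does its supremum. This
    makes [inf] a genuine infimum in [upper_star]. *)
Lemma upper_star_has_inf f : bounded_fun f ->
  has_inf [set sup (range g) | g in translate_combinations f].
Proof.
move=> bf; split.
  by exists (sup (range f)), f => //; exact: translate_combinations_refl.
have /bounded_funP[B HB] := bf.
exists (- B) => _ [g gf <-].
apply: (le_trans _ (le_sup_range g 0 (translate_combinations_bounded f g bf gf))).
have [n [c [t [_ c0 c1 ->]]]] := gf.
rewrite lerNl -sumrN; under eq_bigr do rewrite -mulrN.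
apply: convex_sum_le => // i.
by apply: le_trans (HB (0 + t i)); rewrite -normrN ler_norm.
Qed.

(** Together with [le_upper_star], this replaces [inf] and [sup] by pointwise bounds [g x <= a] on
    combinations; the mean axioms are then checked on such bounds. *)
Lemma upper_star_le f g (a : R) : bounded_fun f ->
  translate_combinations f g -> (forall x, g x <= a) -> upper_star f <= a.
Proof.
move=> bf gf ga; apply: le_trans (sup_range_le g a ga).
by apply: ge_inf; [exact: (upper_star_has_inf f bf).2 | exists g].
Qed.

Lemma le_upper_star f (b : R) : bounded_fun f ->
  (forall g a, translate_combinations f g -> (forall x, g x <= a) -> b <= a) ->
  b <= upper_star f.
Proof.
move=> bf H; apply: lb_le_inf; first exact: (upper_star_has_inf f bf).1.
move=> _ [g gf <-]; apply: (H g) => // x; apply: le_sup_range.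
exact: translate_combinations_bounded gf.
Qed.

Lemma upper_star_cst (c : R) : upper_star (fun _ : G => c) = c.
Proof.
have bc : bounded_fun (fun _ : G => c) by exact: bounded_fun_cst.
apply/eqP; rewrite eq_le; apply/andP; split.
  exact: upper_star_le (translate_combinations_refl _) _.
apply: le_upper_star => // g a [n [d [t [_ _ d1 ->]]]] /(_ 0).
by rewrite -mulr_suml d1 mul1r.
Qed.

Lemma upper_star_monotone f g : bounded_fun f -> bounded_fun g ->
  (forall x, f x <= g x) -> upper_star f <= upper_star g.
Proof.
move=> bf bg fg; apply: le_upper_star => // _ a [n [c [t [n0 c0 c1 ->]]]] ga.
apply: (upper_star_le f (fun x => \sum_(i < n) c i * f (x + t i))) => //.
  exact: translate_combinations_fin.
by move=> x; apply: le_trans (ga x); apply: ler_sum => i _; exact: ler_wpM2l.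
Qed.

Lemma upper_star_scale_le (c : R) f : bounded_fun f -> 0 < c ->
  upper_star (fun x => c * f x) <= c * upper_star f.
Proof.
move=> bf c0; rewrite -ler_pdivrMl//.
apply: le_upper_star => // _ a [n [d [t [n0 d0 d1 ->]]]] ga.
rewrite ler_pdivrMl//.
apply: (upper_star_le _ (fun x => \sum_(i < n) d i * (c * f (x + t i)))).
- exact: bounded_funZ.
- exact: (translate_combinations_fin _ d t (fun x => c * f x)).
- move=> x; under eq_bigr do rewrite mulrCA.
  by rewrite -mulr_sumr ler_pM2l.
Qed.

Lemma upper_star_homogeneous (c : R) f : bounded_fun f -> 0 <= c ->
  upper_star (fun x => c * f x) = c * upper_star f.
Proof.
move=> bf; rewrite le_eqVlt => /predU1P[<-|c0].
  under eq_fun do rewrite mul0r.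
  by rewrite mul0r upper_star_cst.
apply/eqP; rewrite eq_le upper_star_scale_le//=.
(* The reverse inequality is the scaling bound for the factor [c^-1] and the function [c * f]. *)
have fK : (fun x => c^-1 * (c * f x)) = f.
  by apply/funext => x; rewrite mulKf ?gt_eqF.
rewrite -ler_pdivlMl// -[in leLHS]fK.
by apply: (upper_star_scale_le c^-1); [exact: bounded_funZ | rewrite invr_gt0].
Qed.

(* Averaging operators commute: if [S1 f <= a] and [S2 g <= b], then
   [S1 (S2 (f + g)) = S2 (S1 f) + S1 (S2 g)] is at most
   [a + b]. *)
Lemma upper_star_subadditive f g : bounded_fun f -> bounded_fun g ->
  upper_star (fun x => f x + g x) <= upper_star f + upper_star g.
Proof.
(* The two infima are treated one at a time, the other being moved to the left-hand side. *)
move=> bf bg; rewrite -lerBlDr; apply: le_upper_star => //.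
move=> _ a [n [c [t [_ c0 c1 ->]]]] fa.
rewrite lerBlDr -lerBlDl; apply: le_upper_star => //.
move=> _ b [m [d [s [_ d0 d1 ->]]]] gb; rewrite lerBlDl.
pose h x := \sum_(p : 'I_n * 'I_m)
  c p.1 * d p.2 * (f (x + (t p.1 + s p.2)) + g (x + (t p.1 + s p.2))).
apply: (upper_star_le _ h); first exact: bounded_funD.
  apply: (translate_combinations_fin _ (fun p : 'I_n * 'I_m => c p.1 * d p.2)
    (fun p => t p.1 + s p.2) (fun x => f x + g x)).
    by move=> p; exact: mulr_ge0.
  exact: convex_sum_prod.
move=> x; rewrite /h; under eq_bigr do rewrite mulrDr.
rewrite big_split /=; apply: lerD.
(* With the sum over [j] outermost, the inner sum is the first combination at [x + s j], which is at
   most [a]. *)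
- rewrite -(pair_bigA _ (fun i j => c i * d j * f (x + (t i + s j)))) /= exchange_big /=.
  under eq_bigr => j _.
    under eq_bigr => i _ do rewrite (mulrC (c i)) -mulrA (addrC (t i)) addrA.
    rewrite -mulr_sumr; over.
  by apply: convex_sum_le => // j; exact: fa.
- rewrite -(pair_bigA _ (fun i j => c i * d j * g (x + (t i + s j)))) /=.
  under eq_bigr => i _.
    under eq_bigr => j _ do rewrite -mulrA addrA.
    rewrite -mulr_sumr; over.
  by apply: convex_sum_le => // i; exact: gb.
Qed.

(** By commutativity, averaging the shifted function gives the average of [f] evaluated at [x + t],
    so a uniform upper bound survives. *)
Lemma upper_star_shift_le (t : G) f : bounded_fun f ->
  upper_star (fun x => f (x + t)) <= upper_star f.
Proof.
move=> bf; apply: le_upper_star => // _ a [n [c [s [_ c0 c1 ->]]]] fa.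
apply: (upper_star_le _ (fun x => \sum_(i < n) c i * f (x + s i + t))).
- exact: bounded_fun_shift.
- exact: (translate_combinations_fin _ c s (fun x => f (x + t))).
- by move=> x; under eq_bigr do rewrite addrAC; exact: fa.
Qed.

(* For the nontrivial inequality: a combination of translates of
   [(f + f (_ + t)) / 2] is one of translates of [f]. *)
Lemma upper_star_restricted_additive (t : G) f : bounded_fun f ->
  upper_star (fun x => f x + f (x + t)) = 2 * upper_star f.
Proof.
move=> bf; have bft := bounded_fun_shift t f bf.
apply/eqP; rewrite eq_le; apply/andP; split.
  apply: le_trans (upper_star_subadditive _ _ bf bft) _.
  by rewrite mulr_natl mulr2n lerD2l upper_star_shift_le.
apply: le_upper_star; first exact: bounded_funD.
move=> _ a [n [c [s [_ c0 c1 ->]]]] ga; rewrite -ler_pdivlMl//.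
have half : \sum_(b : bool) (2^-1 : R) = 1.
  by rewrite big_bool /= -[X in X + _]div1r -[X in _ + X]div1r -splitr.
(* Each weight [c i] is split equally between the translations by [s i] and by [s i + t]. *)
pose h x := \sum_(p : 'I_n * bool)
  c p.1 * 2^-1 * f (x + (s p.1 + (if p.2 then t else 0))).
apply: (upper_star_le _ h) => //.
  apply: (translate_combinations_fin _ (fun p : 'I_n * bool => c p.1 * 2^-1)
    (fun p => s p.1 + (if p.2 then t else 0))).
    by move=> p; rewrite mulr_ge0.
  exact: (convex_sum_prod _ _ c (fun=> 2^-1)).
move=> x.
suff -> : h x = 2^-1 * \sum_(i < n) c i * (f (x + s i) + f (x + s i + t)).
  by rewrite ler_pM2l// ga.
rewrite /h -(pair_bigA _ (fun i (b : bool) =>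
  c i * 2^-1 * f (x + (s i + (if b then t else 0))))) /= mulr_sumr.
apply: eq_bigr => i _.
by rewrite big_bool /= addr0 addrA -mulrDr mulrA [2^-1 * _]mulrC [f _ + _]addrC.
Qed.

Lemma upper_star_upper_mean : upper_mean (@upper_star R G).
Proof.
split; last exact: upper_star_subadditive.
split.
- exact: upper_star_cst.
- exact: upper_star_monotone.
- exact: upper_star_homogeneous.
- exact: upper_star_restricted_additive.
Qed.

End UpperStar.

(** * Maximality of [upper_star] among upper means *)

Section Maximality.
Context {R : realType} {G : zmodType} (M : (G -> R) -> R)
  (M_upper : upper_mean M).

Lemma upper_mean_le_cst (f : G -> R) (a : R) :
  bounded_fun f -> (forall x, f x <= a) -> M f <= a.
Proof.
move=> bf fa; have ax := upper_mean_axioms M_upper.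
by rewrite -[leRHS](mean_norming ax); apply: (mean_monotone ax) => //; exact: bounded_fun_cst.
Qed.

Lemma upper_mean_sum_le (I : Type) (r : seq I) (F : I -> G -> R) :
  (forall i, bounded_fun (F i)) ->
  M (fun x => \sum_(i <- r) F i x) <= \sum_(i <- r) M (F i).
Proof.
move=> bF; elim: r => [|i r IH].
  under eq_fun do rewrite big_nil.
  by rewrite (mean_norming (upper_mean_axioms M_upper)) big_nil.
under eq_fun do rewrite big_cons.
rewrite big_cons; apply: le_trans (lerD (lexx _) IH).
by apply: (upper_mean_subadditive M_upper) => //; exact: bounded_fun_sum.
Qed.

Lemma upper_mean_difference_double (f : G -> R) (t : G) (k : nat) :
  bounded_fun f ->
  M (fun x => f x - f (x + t *+ (2 ^ k))) = 2 ^+ k * M (fun x => f x - f (x + t)).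
Proof.
move=> bf; elim: k => [|k IH]; first by rewrite mulr1n mul1r.
rewrite exprS -mulrA -IH -(mean_restricted_additive (upper_mean_axioms M_upper) (t *+ 2 ^ k)).
  (* The difference for [t *+ 2 ^ k] and its own translate telescope to the difference for twice
     that step. *)
  congr M; apply/funext => x; rewrite addrA subrK -addrA -mulrnDr.
  by rewrite addnn -mul2n -expnS.
by apply: bounded_funD => //; exact/bounded_funN/bounded_fun_shift.
Qed.

Lemma upper_mean_difference_le0 (f : G -> R) (t : G) :
  bounded_fun f -> M (fun x => f x - f (x + t)) <= 0.
Proof.
move=> bf; have /bounded_funP[B HB] := bf.
rewrite leNgt; apply/negP; set m := M _ => m0.
have bound k : 2 ^+ k * m <= B + B.
  rewrite -upper_mean_difference_double//; apply: upper_mean_le_cst.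
    by apply: bounded_funD => //; exact/bounded_funN/bounded_fun_shift.
  move=> x; apply: lerD; first exact: le_trans (ler_norm _) (HB _).
  by apply: le_trans (HB (x + t *+ 2 ^ k)); rewrite -normrN ler_norm.
(* This exponent [k] exceeds [(B + B) / m], and [k < 2 ^ k], so [2 ^+ k * m] is larger than
   [B + B]. *)
have := bound (Num.bound `|(B + B) / m|).
apply/negP; rewrite -ltNge -ltr_pdivrMr//.
apply: (le_lt_trans (ler_norm _)); apply: (lt_trans (archi_boundP (normr_ge0 _))).
by rewrite -natrX ltr_nat ltn_expl.
Qed.

Lemma upper_mean_le_upper_star (f : G -> R) : bounded_fun f -> M f <= upper_star f.
Proof.
move=> bf; have ax := upper_mean_axioms M_upper.
apply: le_upper_star => // _ a [n [c [t [n0 c0 c1 ->]]]] ga.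
pose g x := \sum_(i < n) c i * f (x + t i).
pose d i x := f x - f (x + t i).
have bd i : bounded_fun (d i).
  by apply: bounded_funD => //; exact/bounded_funN/bounded_fun_shift.
have bg : bounded_fun g.
  by apply: bounded_fun_sum => i; exact/bounded_funZ/bounded_fun_shift.
have bcd i : bounded_fun (fun x => c i * d i x) by exact: bounded_funZ.
(* Since the weights sum to 1, [f] is its average [g] plus the averaged differences, whose means are
   nonpositive. *)
have -> : f = (fun x => g x + \sum_(i < n) c i * d i x).
  apply/funext => x; rewrite /g /d -big_split /=.
  under eq_bigr do rewrite -mulrDr addrC subrK.
  by rewrite -mulr_suml c1 mul1r.
apply: (le_trans (upper_mean_subadditive M_upper bg (bounded_fun_sum _ _ _ bcd))).
rewrite -[leRHS]addr0; apply: lerD; first exact: upper_mean_le_cst.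
apply: le_trans (upper_mean_sum_le _ _ (fun i x => c i * d i x) bcd) _.
apply: sumr_le0 => i _; rewrite (mean_homogeneous ax)//.
by apply: mulr_ge0_le0 => //; exact: upper_mean_difference_le0.
Qed.

End Maximality.

(** * Conjugation between upper and lower means *)

Section Conjugation.
Context {R : realType} {G : zmodType}.
Implicit Types (M : (G -> R) -> R) (f : G -> R).

Lemma conjugate_mean_axioms M : mean_axioms M -> mean_axioms (conjugate_mean M).
Proof.
move=> ax; split.
- by move=> c; rewrite /conjugate_mean (mean_norming ax) opprK.
- move=> f g bf bg fg; rewrite lerN2; apply: (mean_monotone ax).
  + exact: bounded_funN.
  + exact: bounded_funN.
  + by move=> x; rewrite lerN2.
- move=> c f bf c0; rewrite /conjugate_mean mulrN -(mean_homogeneous ax) //.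
    by congr (- M _); apply/funext => x; rewrite mulrN.
  exact: bounded_funN.
- move=> t f bf.
  rewrite /conjugate_mean mulrN -(mean_restricted_additive ax t); last exact: bounded_funN.
  by congr (- M _); apply/funext => x; rewrite opprD.
Qed.

Lemma conjugate_upper_mean M : upper_mean M -> lower_mean (conjugate_mean M).
Proof.
move=> [ax sub]; split; first exact: conjugate_mean_axioms.
move=> f g bf bg; rewrite /conjugate_mean -opprD lerN2.
have -> : (fun x => - (f x + g x)) = (fun x => - f x + - g x).
  by apply/funext => x; rewrite opprD.
by apply: sub; exact: bounded_funN.
Qed.

Lemma conjugate_lower_mean M : lower_mean M -> upper_mean (conjugate_mean M).
Proof.
move=> [ax super]; split; first exact: conjugate_mean_axioms.
move=> f g bf bg; rewrite /conjugate_mean -opprD lerN2.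
have -> : (fun x => - (f x + g x)) = (fun x => - f x + - g x).
  by apply/funext => x; rewrite opprD.
by apply: super; exact: bounded_funN.
Qed.

Lemma sup_range_opp (g : G -> R) :
  sup (range (fun x => - g x)) = - inf (range g).
Proof.
(* [inf] is by definition the opposite of the [sup] of the negated set, so an equality of sets
   remains. *)
rewrite /inf opprK; congr sup; apply/seteqP; split.
  by move=> _ [x _ <-]; exists (g x) => //; exists x.
by move=> _ [_ [x _ <-] <-]; exists x.
Qed.

(** Negation matches the combinations of [f] with those of [-f] and exchanges the infimum and
    supremum of their ranges. *)
Lemma lower_star_conjugate :
  @lower_star R G = conjugate_mean (@upper_star R G).
Proof.
apply/funext => f; rewrite /lower_star /conjugate_mean /upper_star /inf opprK.
congr sup; apply/seteqP; split.
  move=> _ [g gf <-]; exists (sup (range (fun x => - g x))).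
    by exists (fun x => - g x) => //; exact: translate_combinationsN.
  by rewrite sup_range_opp opprK.
move=> _ [_ [g gf <-] <-]; exists (fun x => - g x).
  have := translate_combinationsN _ _ gf.
  by under [fun x => - - f x]eq_fun do rewrite opprK.
by apply: oppr_inj; rewrite -[LHS]sup_range_opp opprK; under eq_fun do rewrite opprK.
Qed.

End Conjugation.

Theorem theorem5p1 (R : realType) (G : zmodType)
    (G_infinite : infinite_set [set: G]) :
  [/\ upper_mean (@upper_star R G),
      lower_mean (@lower_star R G) /\
        (forall f : G -> R, bounded_fun f ->
           lower_star f = conjugate_mean (@upper_star R G) f),
      (forall M : (G -> R) -> R, upper_mean M ->
         forall f : G -> R, bounded_fun f -> M f <= upper_star f) &
      (forall M : (G -> R) -> R, lower_mean M ->
         forall f : G -> R, bounded_fun f -> lower_star f <= M f)].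
Proof.
split; first exact: upper_star_upper_mean.
- split; last by move=> f _; rewrite lower_star_conjugate.
  by rewrite lower_star_conjugate; exact/conjugate_upper_mean/upper_star_upper_mean.
- by move=> M M_upper f; exact: upper_mean_le_upper_star.
(* Minimality is maximality applied to the conjugate upper mean of [M] at the function [-f], where
   that mean equals [- M f]. *)
- move=> M M_lower f bf; rewrite lower_star_conjugate /conjugate_mean lerNl.
  have := upper_mean_le_upper_star _ (conjugate_lower_mean M M_lower) _ (bounded_funN f bf).
  rewrite /conjugate_mean.
  by under [X in M X]eq_fun do rewrite opprK.
Qed.
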